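(* Let $S$ be a monoid. For every co-uniform right $S$-act $A$, either $A$ is indecomposable, or $A=A_1\coprod A_2$ where $A_1$ and $A_2$ are simple $S$-acts.
   Context: A right $S$-act over a monoid $S$ is a non-empty set $A$ with a unital associative right action of $S$. A subact of $A$ is a non-empty subset closed under the action; it is proper if it is not equal to $A$. An $S$-act is simple if it has no proper subact. $\coprod$ denotes coproduct, i.e. disjoint union, of acts; an act is indecomposable if it is not the disjoint union of two (non-empty) subacts. A subact $B$ of $A$ is coessential in $A$ if for the canonical epimorphism $\pi:A\to A/B$ onto the Rees factor act (the quotient identifying all elements of $B$ to one point and nothing else), the restriction $\pi|_C$ is not surjective for every proper subact $C$ of $A$. An $S$-act $A$ is co-uniform if every proper subact of $A$ is coessential in $A$. *)

(* Defs.v *)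
From HB Require Import structures.
From mathcomp Require Import all_boot.
From mathcomp Require Import boolp classical_sets functions.

Set Implicit Arguments.
Unset Strict Implicit.
Unset Printing Implicit Defensive.

Local Open Scope classical_set_scope.
Local Open Scope group_scope.

HB.mixin Record isRightAct (S : monoidType) (A : Type) := {
  act : A -> S -> A;
  act1 : forall x, act x 1 = x;
  actM : forall x s t, act x (s * t) = act (act x s) t;
  act_nonempty : [set: A] !=set0
}.

#[short(type="rightActType")]
HB.structure Definition RightAct (S : monoidType) := {A of isRightAct S A}.

Record subact (S : monoidType) (A : rightActType S) := Subact {
  subact_set :> set A;
  subact_nonempty : subact_set !=set0;
  subact_closed : forall x s, subact_set x -> subact_set (act x s)
}.

Definition proper_subact (S : monoidType) (A : rightActType S)
  (B : subact A) : Prop := (B : set A) <> [set: A].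

Definition simple_act (S : monoidType) (A : rightActType S) : Prop :=
  ~ exists B : subact A, proper_subact B.

(* A = B ∐ C, as an internal disjoint union. *)
Definition is_coproduct (S : monoidType) (A : rightActType S)
  (B C : subact A) : Prop :=
  B `|` C = [set: A] /\ B `&` C = set0.

Definition indecomposable_act (S : monoidType) (A : rightActType S) : Prop :=
  ~ exists B C : subact A, is_coproduct B C.

Section SubactAct.
Context (S : monoidType) (A : rightActType S) (B : subact A).

Definition subact_type : Type := {x : A | subact_set B x}.

Definition subact_act (u : subact_type) (s : S) : subact_type :=
  exist _ (act (sval u) s) (subact_closed s (svalP u)).

Let subact_act1 u : subact_act u 1 = u.
Proof. by case: u => x Bx; apply: eq_exist; rewrite /= act1. Qed.

Let subact_actM u s t : subact_act u (s * t) = subact_act (subact_act u s) t.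
Proof. by apply: eq_exist; rewrite /= actM. Qed.

Let subact_type_nonempty : [set: subact_type] !=set0.
Proof. by have [x Bx] := subact_nonempty B; exists (exist _ x Bx). Qed.

HB.instance Definition _ :=
  isRightAct.Build S subact_type subact_act1 subact_actM subact_type_nonempty.

End SubactAct.

Section ReesFactor.
Context (S : monoidType) (A : rightActType S) (B : subact A).

Definition rees_class (x : A) : set A := [set y | x = y \/ (subact_set B x /\ subact_set B y)].

Definition rees_factor : Type := {P : set A | exists x, P = rees_class x}.

Definition rees_proj (x : A) : rees_factor :=
  exist _ (rees_class x) (ex_intro _ x erefl).

Lemma rees_projP x y :
  rees_proj x = rees_proj y <-> x = y \/ (subact_set B x /\ subact_set B y).
Proof.
split=> [/(congr1 sval) /= exy|[->//|[Bx By]]].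
  by have : rees_class y y by [left]; rewrite -exy.
apply: eq_exist; apply/seteqP; rewrite /rees_class.
by split=> z /= [<-|[]]; right.
Qed.

Lemma rees_proj_surj : set_surj [set: A] [set: rees_factor] rees_proj.
Proof. by move=> [P [x Px]] _; exists x => //; apply: eq_exist. Qed.

Lemma rees_class_act x s :
  [set z | exists2 y, rees_class x y & rees_class (act y s) z] =
  rees_class (act x s).
Proof.
apply/seteqP; split=> z /=; last by exists x => //; left.
move=> [y [<-//|[Bx By]] [<-|[_ Bz]]]; right; split=> //;
  exact: subact_closed.
Qed.

(* The action on classes, [x] s = [x s], stated without a choice of
   representative. *)
Definition rees_act (p : rees_factor) (s : S) : rees_factor :=
  exist _ [set z | exists2 y, sval p y & rees_class (act y s) z]
    (let: ex_intro x px := svalP p in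
     ex_intro _ (act x s)
       (eq_trans
          (congr1 (fun P : set A =>
             [set z | exists2 y, P y & rees_class (act y s) z]) px)
          (rees_class_act x s))).

Lemma rees_proj_act x s : rees_proj (act x s) = rees_act (rees_proj x) s.
Proof. by apply: eq_exist; rewrite /= rees_class_act. Qed.

Let rees_act1 p : rees_act p 1 = p.
Proof.
by have [x _ <-] := rees_proj_surj (I : setT p); rewrite -rees_proj_act act1.
Qed.

Let rees_actM p s t : rees_act p (s * t) = rees_act (rees_act p s) t.
Proof.
by have [x _ <-] := rees_proj_surj (I : setT p); rewrite -!rees_proj_act actM.
Qed.

Let rees_factor_nonempty : [set: rees_factor] !=set0.
Proof. by have [x _] := act_nonempty (s := A); exists (rees_proj x). Qed.

HB.instance Definition _ :=
  isRightAct.Build S rees_factor rees_act1 rees_actM rees_factor_nonempty.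

End ReesFactor.

Definition coessential (S : monoidType) (A : rightActType S)
  (B : subact A) : Prop :=
  forall C : subact A, proper_subact C ->
    ~ set_surj C [set: rees_factor B] (rees_proj B).

Definition co_uniform (S : monoidType) (A : rightActType S) : Prop :=
  forall B : subact A, proper_subact B -> coessential B.

(* Main.v *)
Require Import Defs.
From mathcomp Require Import all_boot.
From mathcomp Require Import boolp classical_sets functions.

(** The map [C -> A/B] is onto exactly when [B] and [C] meet and cover [A], so
    in a co-uniform act two proper subacts that cover [A] are disjoint.  If
    [A] is the disjoint union of [B] and [C] and [D] is a proper subact of
    [B], then [B] and [D `|` C] are proper, cover [A] and meet in [D]. *)

Section Subacts.
Local Open Scope classical_set_scope.
Context {S : monoidType} {A : rightActType S}.

Definition subact_union (B C : subact A) : subact A.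
Proof.
exists (B `|` C); first by have [x Bx] := subact_nonempty B; exists x; left.
by move=> x s [] ?; [left|right]; exact: subact_closed.
Defined.

(** Simplicity of [B] speaks of subacts of the sigma type, co-uniformity of subacts of [A]; this
    passes from the former to the latter. *)
Definition subact_image (B : subact A) (D : subact (subact_type B)) : subact A.
Proof.
exists (sval @` D).
  by have [u Du] := subact_nonempty D; exists (sval u); exists u.
by move=> _ s [u Du <-]; exists (act u s) => //; exact: subact_closed.
Defined.

(** A class with a representative in [C] is hit by that representative; the only other possible
    class is the collapsed [B], hit by any common point of [B] and [C]. *)
Lemma rees_proj_restr_surj (B C : subact A) :
  B `|` C = [set: A] -> B `&` C !=set0 ->
  set_surj C [set: rees_factor B] (rees_proj B).
Proof.
move=> BCT [y [By Cy]] p _.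
have [x _ <-] := rees_proj_surj (I : setT p).
have : (B `|` C) x by rewrite BCT.
case=> [Bx|Cx]; last by exists x.
by exists y => //; apply/rees_projP; right.
Qed.

Lemma co_uniform_disjoint (B C : subact A) :
  co_uniform A -> proper_subact B -> proper_subact C ->
  B `|` C = [set: A] -> B `&` C = set0.
Proof.
move=> cuA pB pC BCT; apply: contrapT => /eqP/set0P BC0.
exact: (cuA B pB C pC (rees_proj_restr_surj _ _ BCT BC0)).
Qed.

Lemma is_coproductC (B C : subact A) : is_coproduct B C -> is_coproduct C B.
Proof. by case=> BCT BC0; split; rewrite 1?setUC 1?setIC. Qed.

(** [C] is non-empty, and [B] misses all of its points. *)
Lemma is_coproduct_proper (B C : subact A) : is_coproduct B C -> proper_subact B.
Proof.
move=> [_ BC0] BT; have [x Cx] := subact_nonempty C.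
by have : (B `&` C) x; [rewrite BT | rewrite BC0].
Qed.

Lemma co_uniform_summand_simple (B C : subact A) :
  co_uniform A -> is_coproduct B C -> simple_act (subact_type B).
Proof.
move=> cuA BC [D pD]; have [BCT BC0] := BC.
pose E := subact_union (subact_image B D) C.
have pE : proper_subact E.
  (* If [E] were all of [A], each point of [B], lying outside [C], would come from [D]. *)
  move=> ET; apply: pD; apply/seteqP; split=> // -[x Bx] _.
  have : subact_set E x by rewrite ET.
  case=> [[[y By] Dy /= yx]|Cx]; last first.
    by have : (B `&` C) x; [split | rewrite BC0].
  (* The point of [D] over [x] may carry a different proof of membership in [B]. *)
  by subst y; rewrite (Prop_irrelevance Bx By).
have BET : B `|` E = [set: A].
  apply/seteqP; split=> // x _; have : (B `|` C) x by rewrite BCT.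
  by case=> [Bx|Cx]; [left | right; right].
have BE0 := co_uniform_disjoint B E cuA (is_coproduct_proper _ _ BC) pE BET.
(* Any point of [D] lies in both [B] and [E], against their disjointness. *)
have [u Du] := subact_nonempty D.
have : (B `&` E) (sval u) by split; [exact: (svalP u) | left; exists u].
by rewrite BE0.
Qed.

End Subacts.

Theorem proposition3p5 (S : monoidType) (A : rightActType S) :
  co_uniform A ->
  indecomposable_act A \/
  exists A1 A2 : subact A,
    is_coproduct A1 A2 /\
    simple_act (subact_type A1) /\ simple_act (subact_type A2).
Proof.
move=> cuA; have [|/contrapT [B [C BC]]] := EM (indecomposable_act A); [by left | right].
exists B, C; split=> //; split.
  exact: co_uniform_summand_simple cuA BC.
exact: co_uniform_summand_simple cuA (is_coproductC _ _ BC).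
Qed.
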